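(* Let $R,S$ be Dedekind domains with torsion class group, let $h:G(R)\longrightarrow G(S)$ be a homeomorphism, and let $P$ be a nonzero prime ideal of $R$. Then the restriction of $h$ to $R\setminus P$ is a homeomorphism between $R\setminus P$ with the $P$-topology and $S\setminus h(P)$ with the $h(P)$-topology.
   Context: A Dedekind domain is a one-dimensional Noetherian integrally closed domain. For an integral domain $R$, set $R^\bullet:=R\setminus\{0\}$. The Golomb space $G(R)$ is the set $R^\bullet$ endowed with the topology generated by the cosets $a+I$, where $a\in R$ and $I$ is a nonzero ideal of $R$ such that $\langle a,I\rangle=R$. The class group of $R$ is the group of nonzero fractional ideals of $R$ modulo principal fractional ideals. For a nonzero prime ideal $P$ of $R$, the $P$-topology is the topology on $R\setminus P$ generated by the subsets $\Omega\subseteq R\setminus P$ that are clopen in $R\setminus P$ with respect to the (subspace topology of the) Golomb topology; it coincides with the restriction to $R\setminus P$ of the $P$-adic topology, i.e., the topology generated by the cosets $a+P^n$, $a\in R\setminus P$, $n\geq 1$. Here $h(P)$ means $h(P\setminus\{0\})\cup\{0\}$; for $R,S$ with torsion class group it is a nonzero prime ideal of $S$. *)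

(* Defs.v *)
From HB Require Import structures.
From mathcomp Require Import all_boot all_order all_algebra.
From mathcomp Require Import fraction.
From mathcomp Require Import all_classical topology.

Set Implicit Arguments.
Unset Strict Implicit.
Unset Printing Implicit Defensive.

Import GRing.Theory.
Local Open Scope classical_set_scope.
Local Open Scope ring_scope.

Section Dedekind.
Variable R : idomainType.
Implicit Types (I J : set R) (A : set R).

(* Unlike [idealr_closed], the unit ideal [setT] is allowed. *)
Definition is_ideal I : Prop :=
  [/\ I 0, forall x y, I x -> I y -> I (x + y)
    & forall a x, I x -> I (a * x)].

Definition nonzero_ideal I : Prop :=
  is_ideal I /\ exists2 x, I x & x != 0.

Definition is_prime_ideal I : Prop :=
  [/\ is_ideal I, ~ I 1 & forall x y, I (x * y) -> I x \/ I y].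

Definition ideal_gen A : set R := smallest is_ideal A.

Definition noetherian : Prop :=
  forall I, is_ideal I -> exists2 A, finite_set A & I = ideal_gen A.

(* Chains c 0 < c 1 < ... < c n; the values of c beyond n are irrelevant. *)
Definition has_prime_chain (n : nat) : Prop :=
  exists c : nat -> set R,
    (forall i, (i <= n)%N -> is_prime_ideal (c i)) /\
    (forall i, (i < n)%N -> c i `<` c i.+1).

Definition krull_dim_eq (n : nat) : Prop :=
  has_prime_chain n /\ ~ has_prime_chain n.+1.

Definition integrally_closed : Prop :=
  forall z : {fraction R},
    integralOver (@tofrac R) z -> range (@tofrac R) z.

Definition dedekind_domain : Prop :=
  [/\ krull_dim_eq 1, noetherian & integrally_closed].

Implicit Types (F G : set {fraction R}).

Definition is_frac_submod F : Prop :=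
  [/\ F 0, forall x y, F x -> F y -> F (x + y)
    & forall (a : R) x, F x -> F (tofrac a * x)].

Definition nonzero_frac_ideal F : Prop :=
  [/\ is_frac_submod F, exists2 x, F x & x != 0
    & exists2 d : R, d != 0
        & forall x, F x -> range (@tofrac R) (tofrac d * x)].

Definition frac_mul F G : set {fraction R} :=
  smallest is_frac_submod [set x * y | x in F & y in G].

Definition frac_principal (z : {fraction R}) : set {fraction R} :=
  [set z * tofrac a | a in [set: R]].

Definition frac_exp F (n : nat) : set {fraction R} :=
  iter n (frac_mul F) (frac_principal 1).

(* Equality in the class group, for nonzero fractional ideals. *)
Definition same_ideal_class F G : Prop :=
  exists2 z : {fraction R}, z != 0 & F = frac_mul (frac_principal z) G.

Definition torsion_class_group : Prop :=
  forall F, nonzero_frac_ideal F ->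
    exists2 n, (0 < n)%N & same_ideal_class (frac_exp F n) (frac_principal 1).

End Dedekind.

Definition golomb (R : idomainType) : Type := {x : R | x != 0}.

HB.instance Definition _ (R : idomainType) := SubChoice.on (golomb R).

(* The trace on the nonzero elements of a + I matters only when I = R, since
   0 \in a + I and <a, I> = R force I = R. *)
Definition golomb_subbase (R : idomainType) : set (set (golomb R)) :=
  [set U | exists (a : R) (I : set R),
     [/\ nonzero_ideal I, ideal_gen (a |` I) = setT
       & U = \val @^-1` [set a + x | x in I]]].

HB.instance Definition _ (R : idomainType) :=
  @isSubBaseTopological.Build (golomb R)
    (set (golomb R)) (@golomb_subbase R) id.

(* R \ P as a subset of G(R); the type it coerces to carries the subspace
   topology of the Golomb topology. *)
Definition golomb_minus (R : idomainType) (P : set R) : set (golomb R) :=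
  [set x | ~ P (\val x)].

(* An alias of R \ P, so as to carry the P-topology instead. *)
Definition Pspace (R : idomainType) (P : set R) : Type := golomb_minus P.

HB.instance Definition _ (R : idomainType) (P : set R) :=
  Choice.copy (Pspace P) (set_type (golomb_minus P)).

HB.instance Definition _ (R : idomainType) (P : set R) :=
  @isSubBaseTopological.Build (Pspace P)
    (set (golomb_minus P)) [set U | clopen U] id.

Definition homeomorphism (X Y : topologicalType) (f : X -> Y) : Prop :=
  continuous f /\
  exists g : Y -> X, [/\ cancel f g, cancel g f & continuous g].

Definition golomb_image (R S : idomainType) (h : golomb R -> golomb S)
    (P : set R) : set S :=
  0 |` [set \val (h x) | x in [set x : golomb R | P (\val x)]].

(* g is the restriction of h, as a map from R \ P to S \ Q. *)
Definition is_restriction (R S : idomainType) (h : golomb R -> golomb S)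
    (P : set R) (Q : set S) (g : Pspace P -> Pspace Q) : Prop :=
  forall x : golomb_minus P, set_val (g x : golomb_minus Q) = h (set_val x).

(* Main.v *)
Require Import Defs.
From mathcomp Require Import all_boot all_order all_algebra.
From mathcomp Require Import all_classical topology.

(** The P-topology is defined from the Golomb topology alone: its generators
are the clopen subsets of the subspace R \ P.  So every continuous map between
such complements is also continuous for the P-topologies, because preimages of
clopen sets are clopen and preimages commute with unions and finite
intersections ([continuous_Pspace]).  It remains to see that h restricts to a
homeomorphism of subspaces.  Since h is injective and never takes the value 0,
a nonzero x lies in P exactly when h(x) lies in h(P) ([golomb_image_val]);
hence h and its inverse exchange R \ P and S \ h(P), and restrictions of
continuous maps are continuous ([continuous_sigLR]). *)

Local Open Scope classical_set_scope.

Lemma clopen_Pspace_open (R : idomainType) (P : set R)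
    (U : set (golomb_minus P)) :
  clopen U -> open (U : set (Pspace P)).
Proof.
move=> clU; exists [set U]; last by rewrite bigcup_set1.
by move=> _ ->; exact: finI_from1.
Qed.

(** Preimages of clopen sets are clopen, so f pulls generators of one
P-topology back to generators of the other.  Mere openness of the preimages
would not suffice, since a Golomb-open set need not be open here. *)
Lemma continuous_Pspace (R S : idomainType) (P : set R) (Q : set S)
    (f : golomb_minus P -> golomb_minus Q) :
  continuous f -> continuous (f : Pspace P -> Pspace Q).
Proof.
move=> ctsf; apply/continuousP => _ [D sD <-].
(* An open set is a union, over D, of finite intersections of clopen sets. *)
rewrite preimage_bigcup; apply: bigcup_open => V /sD[E sE <-].
rewrite preimage_bigcap bigcap_fset big_seq.
elim/big_ind : _ => [||W EW]; [exact: openT|exact: openI|].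
apply: clopen_Pspace_open; apply: preimage_clopen ctsf.
by have /set_mem := sE _ EW.
Qed.

Lemma continuous_sigLR (X Y : topologicalType) (A : set X) (B : set Y)
    (f : {fun A >-> B}) : continuous f -> continuous (sigLR f).
Proof.
move=> ctsf; apply: continuous_comp_initial => x.
apply: (@continuous_comp _ _ _ (set_val : A -> X) f); last exact: ctsf.
exact: initial_continuous.
Qed.

(** The point 0 adjoined to the image of P is harmless, as points of the
Golomb space are nonzero; injectivity does the rest. *)
Lemma golomb_image_val (R S : idomainType) (h : golomb R -> golomb S)
    (P : set R) (x : golomb R) :
  injective h -> golomb_image h P (\val (h x)) <-> P (\val x).
Proof.
move=> injh; split=> [[/eqP|[y Py /val_inj/injh <- //]]|Px].
  by rewrite (negPf (valP (h x))).
by right; exists x.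
Qed.

Theorem theorem3p3 (R S : idomainType)
    (dedR : dedekind_domain R) (dedS : dedekind_domain S)
    (torR : torsion_class_group R) (torS : torsion_class_group S)
    (h : golomb R -> golomb S) (homeo_h : homeomorphism h)
    (P : set R) (primeP : is_prime_ideal P) (nzP : nonzero_ideal P) :
  exists g : Pspace P -> Pspace (golomb_image h P),
    is_restriction h g /\ homeomorphism g.
Proof.
have [ctsh [k [hK kK ctsk]]] := homeo_h.
set Q := golomb_image h P.
have hQ x : golomb_minus Q (h x) <-> golomb_minus P x.
  have PQ := golomb_image_val R S h P x (can_inj hK).
  by split=> + Px; apply; apply/PQ.
have hPQ : set_fun (golomb_minus P) (golomb_minus Q) h by move=> x /hQ.
have kQP : set_fun (golomb_minus Q) (golomb_minus P) k.
  by move=> y; rewrite -{1}(kK y) => /hQ.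
exists (sigLR [fun of mkfun hPQ]); split=> //.
split; first by apply: continuous_Pspace; exact: continuous_sigLR.
exists (sigLR [fun of mkfun kQP]); split.
- by move=> x; apply: val_inj; exact: hK.
- by move=> y; apply: val_inj; exact: kK.
- by apply: continuous_Pspace; exact: continuous_sigLR.
Qed.
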